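(* Let $\mathbb{Z}^2$ be equipped with the connection $\mathcal{C}$ induced by a neighbor relation $r$ as in the context, and let $f\in\mathcal{A}(\mathbb{Z}^2)$ have finite support. Then there exist $\gamma(k)\in\mathbb{N}$ and pulses $\phi_{ks}$, $k\in\mathbb{N}$, $s=1,\dots,\gamma(k)$, such that: (1) $((id-U_k\circ L_k)\circ F_{k-1})(f)=\sum_{s=1}^{\gamma(k)}\phi_{ks}$ for every $k\in\mathbb{N}$; (2) $\mathrm{supp}(\phi_{ks_1})\cap\mathrm{supp}(\phi_{ks_2})=\emptyset$ for $s_1\neq s_2$; (3) if $k_1<k_2$, $1\le s_1\le\gamma(k_1)$, $1\le s_2\le\gamma(k_2)$ and $\mathrm{supp}(\phi_{k_1s_1})\cap\mathrm{supp}(\phi_{k_2s_2})\neq\emptyset$, then $\mathrm{supp}(\phi_{k_1s_1})\subset\mathrm{supp}(\phi_{k_2s_2})$; (4) for a sufficiently large $m$ the function $F_m(f)$ is a constant $c$, and then $$f=\sum_{k=1}^m\sum_{s=1}^{\gamma(k)}\phi_{ks}+c,$$ and this decomposition is total variation preserving in the sense that $$TV(f)=\sum_{k=1}^m\sum_{s=1}^{\gamma(k)}TV(\phi_{ks}).$$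
   Context: $\mathbb{N}=\{1,2,\dots\}$. $\mathcal{A}(\mathbb{Z}^2)$ is the space of all functions $f:\mathbb{Z}^2\to\mathbb{R}$ with pointwise operations; $id$ is the identity operator and $(id-P)(f)=f-P(f)$. Neighbor relation: $r$ is a relation on $\mathbb{Z}^2$ which is reflexive, symmetric and shift invariant, and satisfies $((i,j),(i\pm1,j))\in r$ and $((i,j),(i,j\pm1))\in r$ for all $i,j\in\mathbb{Z}$; $p,q$ are neighbors if $(p,q)\in r$. A set $C\subseteq\mathbb{Z}^2$ is connected if for any two $p,q\in C$ there is a set $\{p_1,\dots,p_k\}\subseteq C$ such that $p$ is a neighbor of $p_1$, each $p_i$ is a neighbor of $p_{i+1}$, and $p_k$ is a neighbor of $q$. $\mathcal{C}$ is the family of all connected sets. For $x\in\mathbb{Z}^2$, $n\in\mathbb{N}$ let $\mathcal{N}_n(x)=\{V\in\mathcal{C}:x\in V,\ \mathrm{card}(V)=n+1\}$ and $$L_n(f)(x)=\max_{V\in\mathcal{N}_n(x)}\min_{y\in V}f(y),\qquad U_n(f)(x)=\min_{V\in\mathcal{N}_n(x)}\max_{y\in V}f(y).$$ Define $F_0=id$, $F_1=U_1\circ L_1$ and $F_n=U_n\circ L_n\circ F_{n-1}$. A pulse is a function $\phi\in\mathcal{A}(\mathbb{Z}^2)$ for which there exist a connected set $V$ and a real number $\alpha$ with $\phi(x)=\alpha$ for $x\in V$ and $\phi(x)=0$ for $x\in\mathbb{Z}^2\setminus V$; the set $V$ is called the support of the pulse and is denoted $\mathrm{supp}(\phi)$.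 Total variation: $TV(f)=\sum_{i=-\infty}^\infty\sum_{j=-\infty}^\infty\big(|f(i+1,j)-f(i,j)|+|f(i,j+1)-f(i,j)|\big)$. *)

(* Defs.v *)
From HB Require Import structures.
From mathcomp Require Import all_boot all_order all_algebra.
From mathcomp Require Import all_classical all_reals ereal esum.

Set Implicit Arguments.
Unset Strict Implicit.
Unset Printing Implicit Defensive.

Import Order.TTheory GRing.Theory Num.Theory.

Local Open Scope classical_set_scope.
Local Open Scope ring_scope.

Notation Z2 := (int * int)%type.

Definition neighbor_relation (r : rel Z2) : Prop :=
  [/\ reflexive r, symmetric r,
      forall a p q : Z2, r (p + a) (q + a) = r p q &
      forall i j : int,
        [/\ r (i, j) (i + 1, j), r (i, j) (i - 1, j),
            r (i, j) (i, j + 1) & r (i, j) (i, j - 1)]].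

Definition connected_set (r : rel Z2) (C : set Z2) : Prop :=
  forall p q : Z2, C p -> C q ->
    exists s : seq Z2,
      [/\ s != [::], {in s, forall x, C x} & path r p (rcons s q)].

Definition nbhd_sets (r : rel Z2) (n : nat) (x : Z2) : set (set Z2) :=
  [set V | [/\ connected_set r V, V x & (V #= `I_n.+1)%card]].

(* Each V below is finite and nonempty, so the inner inf / sup is a minimum /
   maximum.  The outer sup / inf is attained as soon as f takes finitely many
   values (e.g. has finite support), even when r has infinite neighborhoods. *)
Definition opL (R : realType) (r : rel Z2) (n : nat) (f : Z2 -> R) : Z2 -> R :=
  fun x => sup [set inf (f @` V) | V in nbhd_sets r n x].

Definition opU (R : realType) (r : rel Z2) (n : nat) (f : Z2 -> R) : Z2 -> R :=
  fun x => inf [set sup (f @` V) | V in nbhd_sets r n x].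

Fixpoint opF (R : realType) (r : rel Z2) (n : nat) : (Z2 -> R) -> (Z2 -> R) :=
  if n is m.+1 then opU r n \o opL r n \o opF r m else id.

(* For the zero function V is not determined by phi, hence V is a parameter;
   the empty set is connected. *)
Definition pulse_with_support (R : realType) (r : rel Z2)
    (phi : Z2 -> R) (V : set Z2) : Prop :=
  connected_set r V /\
  exists alpha : R,
    (forall x, V x -> phi x = alpha) /\ (forall x, ~ V x -> phi x = 0).

Definition TV (R : realType) (f : Z2 -> R) : \bar R :=
  (\esum_(i in [set: int]) \esum_(j in [set: int])
    (`|f (i + 1, j) - f (i, j)| + `|f (i, j + 1) - f (i, j)|)%R%:E)%E.

(* Main.v *)
Require Import Defs.
From HB Require Import structures.
From mathcomp Require Import all_boot all_order all_algebra.
From mathcomp Require Import all_classical all_reals ereal esum.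
From mathcomp Require Import zify.

Set Implicit Arguments.
Unset Strict Implicit.
Unset Printing Implicit Defensive.

Import Order.TTheory GRing.Theory Num.Theory.

Local Open Scope classical_set_scope.
Local Open Scope ring_scope.

(** The functions [F_k f] are fixed by both [L_k] and [U_k], so the set
    where [L_(k+1)] lowers [F_k f] is a union of connected plateaus of exactly
    [k+1] points, each strictly above all its outer neighbors; the operator
    lowers each of them to its highest outer neighbor.  Dually for [U_(k+1)].  The removed pulses are thus
    constant on plateaus, plateaus of one operator are pairwise disjoint and no
    edge joins two of them, so on each edge the increments of the function, of
    its smoothed version and of the removed pulses add up in absolute value.
    The smoothed function is constant on a connected set strictly larger than
    each removed plateau; the operators preserve constancy on connected sets, so
    any later plateau meeting this set contains it, which gives the nesting of
    the supports.  Finally all [F_k f] vanish off a fixed finite box, and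
    [U_n] after [L_n] gives [0] once [n] is at least the size of the box. *)

(** * Cardinalities of finite sets, and finite sets of values *)

Lemma card_subset_leq (T : Type) (A B : set T) (m n : nat) :
  A `<=` B -> (A #= `I_m)%card -> (B #= `I_n)%card -> (m <= n)%N.
Proof.
move=> AB /card_eqPle[_ mA] /card_eqPle[Bn _]; rewrite -card_le_II.
by apply: card_le_trans mA _; apply: card_le_trans Bn; apply: subset_card_le.
Qed.

Lemma card_setU1_notin (T : Type) (A : set T) (n : nat) (x : T) :
  (A #= `I_n)%card -> ~ A x -> (A `|` [set x] #= `I_n.+1)%card.
Proof.
move=> An nAx; apply/eq_cardSP; exists x; first by right.
suff -> : (A `|` [set x]) `\ x = A by [].
apply/seteqP; split=> [y [[]//]|y Ay]; split; first by left.
by move=> /= yx; apply: nAx; rewrite -yx.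
Qed.

Lemma card_subset_eq (T : Type) (A B : set T) (n : nat) :
  A `<=` B -> (A #= `I_n)%card -> (B #= `I_n)%card -> A = B.
Proof.
move=> AB An Bn; apply/seteqP; split=> // x Bx; apply: contrapT => nAx.
have := card_subset_leq _ (card_setU1_notin An nAx) Bn; rewrite ltnn.
by move=> H; suff : false by []; apply: H => y [/AB|->].
Qed.

Lemma card_lt_not_subset (T : Type) (A B : set T) (m n : nat) :
  (A #= `I_m)%card -> (B #= `I_n)%card -> (n < m)%N ->
  exists2 x, A x & ~ B x.
Proof.
move=> Am Bn nm; apply: contrapT => nex; suff : (m <= n)%N by rewrite leqNgt nm.
apply: card_subset_leq Am Bn => x Ax.
by apply: contrapT => nBx; apply: nex; exists x.
Qed.

Lemma finite_set_max (R : realDomainType) (A : set R) :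
  finite_set A -> A !=set0 -> exists2 m, A m & forall x, A x -> x <= m.
Proof.
move=> /finite_seqP[s ->]; elim: s => [[x //]|a [|b s] IH] _.
  by exists a => [|x]; rewrite /= inE // => /eqP->.
case: IH => [|m ms mP]; first by exists b; rewrite /= mem_head.
exists (Num.max a m) => [|x].
  by rewrite /= inE; case: leP => _; [rewrite ms orbT|rewrite eqxx].
by rewrite /= inE le_max => /orP[/eqP->|/mP ->]; rewrite ?lexx ?orbT.
Qed.

(** The least value of [f] above [a] serves as [b], and [a + 1] if there is none. A strict bound
    becomes a closed one, the form in which bounds pass through [opL]. *)
Lemma finite_range_gap (R : realDomainType) (T : Type) (f : T -> R) (a : R) :
  finite_set (range f) -> exists2 b, a < b & forall x, a < f x -> b <= f x.
Proof.
move=> fin_f; have [[x ax]|nex] := pselect (exists x, a < f x); last first.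
  by exists (a + 1) => [|x ax]; [rewrite ltrDl ltr01|case: nex; exists x].
pose S := [set - y | y in range f `&` [set y | a < y]].
have [||_ [y [_ /= ay] <-] H] := @finite_set_max _ S.
- by apply: finite_image; apply: sub_finite_set fin_f => z [].
- by exists (- f x); exists (f x) => //; split => //; exists x.
exists y => // z az; rewrite -lerN2; apply: H.
by exists (f z) => //; split=> //; exists z.
Qed.

(** * Connected sets and neighborhoods of prescribed size *)

Section Connection.
Variables (r : rel Z2).
Hypothesis hr : neighbor_relation r.

Let r_refl : reflexive r. Proof. by case: hr. Qed.
Let r_sym : symmetric r. Proof. by case: hr. Qed.

Lemma connected_set1 (x : Z2) : connected_set r [set x].
Proof.
move=> _ _ -> ->; exists [:: x]; split=> //=; last by rewrite !r_refl.
by move=> y; rewrite inE => /eqP ->.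
Qed.

Lemma connected_setU (C D : set Z2) (p q : Z2) :
  connected_set r C -> connected_set r D -> C p -> D q -> r p q ->
  connected_set r (C `|` D).
Proof.
move=> cC cD Cp Dq rpq.
pose link (E : set Z2) u v := exists s : seq Z2,
  [/\ s != [::], {in s, forall x, E x} & path r u (rcons s v)].
have linkS E u v : E `<=` C `|` D -> link E u v -> link (C `|` D) u v.
  by move=> ED [s [s0 sE su]]; exists s; split=> // x /sE /ED.
have link_trans E u v w : E v -> link E u v -> link E v w -> link E u w.
  move=> Ev [s [s0 sE su]] [t [t0 tE tv]]; exists (s ++ v :: t); split.
  - by case: (s).
  - by move=> x; rewrite mem_cat inE => /or3P[/sE|/eqP->|/tE].
  - by rewrite rcons_cat -cat_rcons cat_path last_rcons su.
have link_sym E u v : link E u v -> link E v u.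
  move=> [s [s0 sE su]]; exists (rev s); split.
  - by rewrite -size_eq0 size_rev size_eq0.
  - by move=> x; rewrite mem_rev => /sE.
  - move: su; rewrite -rev_path last_rcons belast_rcons rev_cons.
    by rewrite (@eq_path _ _ r) // => y z; exact: r_sym.
have CD u v : C u -> D v -> link (C `|` D) u v.
  move=> Cu Dv; apply: (link_trans _ _ p); first by left.
    by apply: (linkS C); [left|exact: cC].
  apply: (link_trans _ _ q); first by right.
    (* A link needs a nonempty list of intermediate points, so the single edge from [p] to [q]
       repeats [p], by reflexivity. *)
    exists [:: p]; split=> //=; last by rewrite r_refl rpq.
    by move=> x; rewrite inE => /eqP ->; left.
  by apply: (linkS D); [right|exact: cD].
move=> u v [Cu|Du] [Cv|Dv].
- by apply: (linkS C); [left|exact: cC].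
- exact: CD.
- by apply: link_sym; apply: CD.
- by apply: (linkS D); [right|exact: cD].
Qed.

(** On a chain in [C] from [p] to [q], the first point outside [A] and its predecessor form the
    edge. *)
Lemma connected_exit (C A : set Z2) (p q : Z2) :
  connected_set r C -> C p -> A p -> C q -> ~ A q ->
  exists u v, [/\ C u, A u, C v, ~ A v & r u v].
Proof.
move=> cC Cp Ap Cq nAq; have [s [_ sC]] := cC _ _ Cp Cq.
elim: s p Cp Ap sC => [|a s IH] p Cp Ap sC /=.
  by rewrite andbT => rpq; exists p, q.
case/andP=> rpa sa; have Ca : C a by apply: sC; rewrite mem_head.
have [Aa|nAa] := pselect (A a); last by exists p, a.
by apply: (IH a) => // x xs; apply: sC; rewrite inE xs orbT.
Qed.

Lemma nbhd_sets_set1 (x : Z2) : nbhd_sets r 0 x [set x].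
Proof. by split=> //; [exact: connected_set1|exact: card_set1]. Qed.

Lemma nbhd_sets_setU1 (n : nat) (x p q : Z2) (V : set Z2) :
  nbhd_sets r n x V -> V p -> ~ V q -> r p q ->
  nbhd_sets r n.+1 x (V `|` [set q]).
Proof.
move=> [cV Vx Vn] Vp nVq rpq; split; [|by left|exact: card_setU1_notin].
by apply: connected_setU Vp _ rpq => //; exact: connected_set1.
Qed.

(** A neighborhood grows from [[set x]] point by point: while it is too small to contain [W],
    connectedness of [C] gives an edge leaving it inside [C]. The set [W] certifies that [C] has
    enough points. *)
Lemma nbhd_sets_subset (n : nat) (x : Z2) (C W : set Z2) :
  connected_set r C -> C x -> W `<=` C -> (W #= `I_n.+1)%card ->
  exists2 V, nbhd_sets r n x V & V `<=` C.
Proof.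
move=> cC Cx WC Wn.
suff /(_ n (leqnn n)) : forall j, (j <= n)%N ->
  exists2 V, nbhd_sets r j x V & V `<=` C by [].
elim=> [_|j IH jn]; first by exists [set x]; [exact: nbhd_sets_set1|move=> _ ->].
have [V NV VC] := IH (ltnW jn); have [cV Vx Vj] := NV.
have [q Wq nVq] : exists2 q, W q & ~ V q by exact: card_lt_not_subset Wn Vj _.
have [u [v [Cu Vu Cv nVv ruv]]] := connected_exit cC Cx Vx (WC _ Wq) nVq.
exists (V `|` [set v]); first exact: nbhd_sets_setU1 ruv.
by move=> y [/VC|->].
Qed.

Lemma nbhd_sets_ray (d : Z2) (height : Z2 -> int) (n : nat) (x : Z2) :
  (forall p, r p (p + d)) -> (forall p, height (p + d) = height p + 1) ->
  exists2 V, nbhd_sets r n x V & forall y, V y -> height x <= height y.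
Proof.
move=> rd hd.
(* The induction also tracks the top of the ray: no point is higher than [height x + n%:Z], so the
   next point along [d] is new. *)
suff [V [NV V1 V2 _]] : exists V, [/\ nbhd_sets r n x V,
    forall y, V y -> height x <= height y,
    forall y, V y -> height y <= height x + n%:Z &
    exists2 z, V z & height z = height x + n%:Z].
  by exists V.
elim: n => [|n [V [NV V1 V2 [z Vz hz]]]].
  exists [set x]; split; [exact: nbhd_sets_set1|by move=> _ -> | | ].
  - by move=> _ ->; rewrite addr0.
  - by exists x => //; rewrite addr0.
have hzd : height (z + d) = height x + n.+1%:Z.
  by rewrite hd hz -addrA -PoszD addn1.
exists (V `|` [set z + d]); split.
- apply: nbhd_sets_setU1 (rd z) => // /V2; rewrite hzd lerD2l lez_nat.
  by rewrite ltnn.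
- by move=> y [/V1//|->]; rewrite hzd lerDl.
- move=> y [/V2 h|->]; last by rewrite hzd.
  by apply: le_trans h _; rewrite lerD2l lez_nat.
- by exists (z + d) => //; right.
Qed.

Lemma nbhd_sets_nonempty (n : nat) (x : Z2) : nbhd_sets r n x !=set0.
Proof.
have [||V NV _] := @nbhd_sets_ray (1, 0) fst n x; last by exists V.
  move=> [i j]; have [_ _ _ /(_ i j)[]] := hr.
  by rewrite -[j in (i + 1, j)]addr0.
by [].
Qed.

End Connection.

(** * The operators on functions with finite range *)

Section Operators.
Variables (R : realType) (r : rel Z2).
Hypothesis hr : neighbor_relation r.
Implicit Types (f g : Z2 -> R) (V W K : set Z2).

Lemma finite_rangeN f : finite_set (range f) -> finite_set (range (- f)).
Proof.
move=> /(finite_image (fun y => - y)); apply: sub_finite_set => _ [x _ <-] /=.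
by exists (f x) => //; exists x.
Qed.

(** Duality: results on [opU] follow from those on [opL] by negation. *)
Lemma opU_opp n f : opU r n f = - opL r n (- f).
Proof.
apply/funext => x; rewrite /opU /opL /inf /= fctE /=; congr (- sup _).
rewrite image_comp; apply: eq_imagel => V _ /=.
congr (- sup _); rewrite image_comp; apply: eq_imagel => y _ /=.
by rewrite fctE opprK.
Qed.

Lemma inf_nbhd_attained n f x V :
  finite_set (range f) -> nbhd_sets r n x V ->
  (exists2 y, V y & inf (f @` V) = f y) /\ (forall y, V y -> inf (f @` V) <= f y).
Proof.
move=> fin_f [_ Vx _]; have lb : has_lbound (f @` V).
  have [||_ [_ [y _ <-] <-] H] := @finite_set_max _ [set - y | y in range f].
  - exact: finite_image.
  - by exists (- f x); exists (f x) => //; exists x.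
  exists (f y) => _ [z _ <-]; rewrite -lerN2; apply: H.
  by exists (f z) => //; exists z.
split=> [|y Vy]; last by apply: ge_inf => //; exists y.
have [||_ [_ [y Vy <-] <-] H] := @finite_set_max _ [set - y | y in f @` V].
- apply: finite_image; apply: sub_finite_set (fin_f) => _ [y _ <-].
  by exists y.
- by exists (- f x); exists (f x) => //; exists x.
exists y => //; apply/eqP; rewrite eq_le; apply/andP; split.
  by apply: ge_inf => //; exists y.
apply: lb_le_inf; first by exists (f x); exists x.
move=> _ [z Vz <-]; rewrite -lerN2; apply: H.
by exists (f z) => //; exists z.
Qed.

(** Each inner infimum is a value of [f], so the outer supremum ranges over finitely many numbers.
    With [opL_ge] this is the max-min description of [opL]. *)
Lemma opL_attained n f x : finite_set (range f) ->
  exists2 V, nbhd_sets r n x V & forall y, V y -> opL r n f x <= f y.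
Proof.
rewrite /opL => fin_f; set S := (X in sup X).
have [V0 NV0] := nbhd_sets_nonempty hr n x.
have [||_ [V NV <-] H] := @finite_set_max _ S.
- apply: sub_finite_set (fin_f) => _ [V NV <-].
  by have [[y _ ->] _] := inf_nbhd_attained fin_f NV; exists y.
- by exists (inf (f @` V0)), V0.
exists V => // y Vy; have [_ /(_ y Vy)] := inf_nbhd_attained fin_f NV.
apply: le_trans; apply: ge_sup => //.
by exists (inf (f @` V0)), V0.
Qed.

Lemma opL_ge n f x V a : finite_set (range f) ->
  nbhd_sets r n x V -> (forall y, V y -> a <= f y) -> a <= opL r n f x.
Proof.
move=> fin_f NV aV; have [[y Vy e] _] := inf_nbhd_attained fin_f NV.
apply: (le_trans (aV y Vy)); rewrite -e; apply: ub_le_sup; last by exists V.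
exists (f x) => _ [W NW <-]; have [_ ->//] := inf_nbhd_attained fin_f NW.
by case: NW.
Qed.

Lemma opL_ge_all n f x V a y : finite_set (range f) ->
  nbhd_sets r n x V -> (forall y, V y -> a <= f y) -> V y -> a <= opL r n f y.
Proof.
move=> fin_f [cV Vx Vn] aV Vy; apply: (@opL_ge n f y V) => //.
Qed.

Lemma opL_le n f x : finite_set (range f) -> opL r n f x <= f x.
Proof. by move=> /(opL_attained n x)[V [_ Vx _]]; apply. Qed.

Lemma opL_range n f x : finite_set (range f) -> range f (opL r n f x).
Proof.
move=> fin_f; have [V NV H] := opL_attained n x fin_f.
have [[y Vy e] H'] := inf_nbhd_attained fin_f NV; exists y => //.
apply/eqP; rewrite eq_le H // andbT -e.
exact: (opL_ge fin_f NV).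
Qed.

Lemma finite_range_opL n f :
  finite_set (range f) -> finite_set (range (opL r n f)).
Proof.
move=> fin_f; apply: sub_finite_set (fin_f) => _ [x _ <-]; exact: opL_range.
Qed.

Lemma finite_range_opU n f :
  finite_set (range f) -> finite_set (range (opU r n f)).
Proof.
rewrite opU_opp => /finite_rangeN /(finite_range_opL n) /finite_rangeN.
by [].
Qed.

(** An optimal set [W] for [z] is glued to [K]. The union is connected, satisfies the bound and has
    enough points, so it contains a neighborhood of [y] of the right size. *)
Lemma opL_ge_connected n f K b z y : finite_set (range f) ->
  connected_set r K -> (forall y, K y -> b <= f y) ->
  K z -> b <= opL r n f z -> K y -> b <= opL r n f y.
Proof.
move=> fin_f cK bK Kz bz Ky; have [W [cW Wz Wn] HW] := opL_attained n z fin_f.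
have [||V NV VKW] := @nbhd_sets_subset r hr n y (K `|` W) W _ (or_introl Ky) _ Wn.
- by apply: connected_setU Kz Wz _ => //; case: hr.
- by move=> u; right.
apply: (opL_ge fin_f NV) => u /VKW[/bK//|/HW]; exact: le_trans.
Qed.

Definition flat f K := forall x y, K x -> K y -> f x = f y.

Lemma flat_opp f K : flat f K -> flat (- f) K.
Proof. by move=> fK x y Kx Ky; rewrite !fctE (fK x y). Qed.

(** The value of [opL] at one point of [K] is at most the constant value of [f] there, so
    [opL_ge_connected] spreads it as a lower bound to any other point. *)
Lemma flat_opL n f K : finite_set (range f) ->
  connected_set r K -> flat f K -> flat (opL r n f) K.
Proof.
move=> fin_f cK fK x y Kx Ky; apply/eqP; rewrite eq_le; apply/andP; split.
- apply: (@opL_ge_connected n f K _ x) => // z Kz.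
  by rewrite (fK z x) // opL_le.
- apply: (@opL_ge_connected n f K _ y) => // z Kz.
  by rewrite (fK z y) // opL_le.
Qed.

Lemma flat_opU n f K : finite_set (range f) ->
  connected_set r K -> flat f K -> flat (opU r n f) K.
Proof.
move=> fin_f cK fK; rewrite opU_opp; apply: flat_opp.
by apply: flat_opL => //; [exact: finite_rangeN|exact: flat_opp].
Qed.

(** For finite range this amounts to [opL r n f = f]; the witness form supplies the neighborhood
    that later becomes a peak. *)
Definition opL_fixed n f :=
  forall x, exists2 V, nbhd_sets r n x V & forall y, V y -> f x <= f y.

(** Idempotence: an optimal set for [x] competes at each of its points. *)
Lemma opL_fixed_opL n f : finite_set (range f) -> opL_fixed n (opL r n f).
Proof.
move=> fin_f x; have [V NV H] := opL_attained n x fin_f.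
by exists V => // y Vy; exact: (opL_ge_all fin_f NV).
Qed.

Lemma opL_fixed0 f : opL_fixed 0 f.
Proof. by move=> x; exists [set x]; [exact: nbhd_sets_set1|move=> _ ->]. Qed.

(* [opL_fixed n (- f)] says that [f] is fixed by [opU r n]. *)
Lemma opU_fixed_opL m n f : finite_set (range f) ->
  opL_fixed n (- f) -> opL_fixed n (- opL r m f).
Proof.
move=> fin_f fixf x; set h := opL r m f.
have hf y : h y <= f y by exact: opL_le.
suff [V NV H] : exists2 V, nbhd_sets r n x V & forall y, V y -> h y <= h x.
  by exists V => // y Vy; rewrite !fctE lerN2; exact: H.
(* The number [b] separates [h x] from all larger values of [f]. *)
have [b hb gap] := finite_range_gap (h x) fin_f.
have fV y : exists2 V, nbhd_sets r n y V & forall z, V z -> f z <= f y.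
  have [V NV H] := fixf y; exists V => // z /H; by rewrite !fctE lerN2.
have [fx|fx] := leP (f x) (h x).
  have [V NV H] := fV x; exists V => // y /H fy.
  exact: le_trans (hf y) (le_trans fy fx).
(* A region around [x] on which [f] is at least [b] grows until it touches a low point of [f], which
   yields the wanted set. With [m.+1] points it would force [b <= h x]. *)
suff /(_ m) [//|[K NK bK]] : forall j,
    (exists2 V, nbhd_sets r n x V & forall y, V y -> h y <= h x) \/
    (exists2 K, nbhd_sets r j x K & forall y, K y -> b <= f y).
  have := opL_ge fin_f NK bK; by rewrite -/h leNgt hb.
elim=> [|j [|[K NK bK]]]; [|by left|].
  by right; exists [set x]; [exact: nbhd_sets_set1|move=> _ ->; exact: gap].
have [cK Kx Kj] := NK.
have [u [v [Ku nKv ruv]]] : exists u v, [/\ K u, ~ K v & r u v].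
  have [C [cC Cx Cj]] := nbhd_sets_nonempty hr j.+1 x.
  have [q Cq nKq] := card_lt_not_subset Cj Kj (leqnn _).
  by have [u [v [_ Ku _ nKv ruv]]] := connected_exit cC Cx Kx Cq nKq; exists u, v.
have [bv|vb] := leP b (f v).
  right; exists (K `|` [set v]); first exact: nbhd_sets_setU1 ruv.
  by move=> y [/bK|->].
have fv : f v <= h x by rewrite leNgt; apply/negP => /gap; rewrite leNgt vb.
(* The wanted set is cut out of [K] and the low neighborhood [W] of [v]. On [W] already [f] is at
   most [h x]; on [K] a value of [h] above [h x] would be at least [b], and this bound would spread
   over [K] to [x]. *)
left; have [W [cW Wv Wn] HW] := fV v.
have [||V NV VKW] := @nbhd_sets_subset r hr n x (K `|` W) W _ (or_introl Kx) _ Wn.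
- exact: connected_setU Ku Wv ruv.
- by move=> y; right.
exists V => // y /VKW[Ky|/HW fy]; last exact: le_trans (hf y) (le_trans fy fv).
rewrite leNgt; apply/negP => hxy; have [z _ fz] := opL_range m y fin_f.
have by_ : b <= h y by rewrite /h -fz; apply: gap; rewrite fz.
by have := opL_ge_connected fin_f cK bK Ky by_ Kx; rewrite -/h leNgt hb.
Qed.

Lemma opL_fixed_opU m n f : finite_set (range f) ->
  opL_fixed n f -> opL_fixed n (opU r m f).
Proof.
move=> /finite_rangeN fin_f fixf; rewrite opU_opp; apply: opU_fixed_opL => //.
by rewrite opprK.
Qed.

Lemma opU_fixed_opU n f :
  finite_set (range f) -> opL_fixed n (- opU r n f).
Proof.
by move=> /finite_rangeN fin_f; rewrite opU_opp opprK; exact: opL_fixed_opL.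
Qed.

Lemma finite_range_opF n f :
  finite_set (range f) -> finite_set (range (opF r n f)).
Proof.
move=> fin_f; elim: n => //= n IH.
by apply: finite_range_opU; exact: finite_range_opL.
Qed.

(** The final [opU] keeps what the preceding [opL] has fixed; level 0 fixes every function. *)
Lemma opL_fixed_opF n f : finite_set (range f) -> opL_fixed n (opF r n f).
Proof.
case: n => [|n] fin_f; first exact: opL_fixed0.
have fin_F := finite_range_opF n fin_f.
by apply: opL_fixed_opU; [exact: finite_range_opL|exact: opL_fixed_opL].
Qed.

Lemma opU_fixed_opF n f : finite_set (range f) -> opL_fixed n (- opF r n f).
Proof.
case: n => [|n] fin_f; first exact: opL_fixed0.
by apply: opU_fixed_opU; apply: finite_range_opL; exact: finite_range_opF.
Qed.

Lemma flat_opF m n f K : finite_set (range f) -> (m <= n)%N ->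
  connected_set r K -> flat (opF r m f) K -> flat (opF r n f) K.
Proof.
move=> fin_f /subnK <- cK fK; elim: (n - m)%N => //= j IH.
apply: flat_opU => //; first by apply: finite_range_opL; exact: finite_range_opF.
by apply: flat_opL => //; exact: finite_range_opF.
Qed.

End Operators.

(** * Peaks, and the pulses removed by one operator *)

Section Peaks.
Variables (R : realType) (r : rel Z2).
Hypothesis hr : neighbor_relation r.
Implicit Types (f g h : Z2 -> R) (V W E : set Z2).

Let r_sym : symmetric r. Proof. by case: hr. Qed.

(** The identity is summed over horizontal and vertical edges; all terms are nonnegative, so the
    extended sums split. *)
Lemma TV_edge_sum (I : choiceType) (s : seq I) (phi : I -> Z2 -> R) g h :
  (forall x y, r x y -> `|g y - g x| =
     `|h y - h x| + \sum_(i <- s) `|phi i y - phi i x|) ->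
  TV g = (TV h + \sum_(i <- s) TV (phi i))%E.
Proof.
move=> edge; pose e f (i j : int) : \bar R :=
  (`|f (i + 1, j) - f (i, j)| + `|f (i, j + 1) - f (i, j)|)%:E.
have e_ge0 f i j : (0 <= e f i j)%E by rewrite lee_fin addr_ge0.
have TVE f : TV f = \esum_(i in [set: int]) \esum_(j in [set: int]) e f i j.
  by [].
rewrite TVE (eq_bigr _ (fun i _ => TVE (phi i))) TVE.
rewrite -esum_sum; last by move=> i l _ _; apply: esum_ge0.
rewrite -esumD; first last.
- by move=> i _; apply: sume_ge0 => l _; apply: esum_ge0.
- by move=> i _; apply: esum_ge0.
apply: eq_esum => i _; rewrite -esum_sum // -esumD //; last first.
  by move=> j _; apply: sume_ge0.
apply: eq_esum => j _; rewrite /e sumEFin -EFinD.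
have [_ _ _ /(_ i j) [r1 _ r2 _]] := hr.
by rewrite (edge _ _ r1) (edge _ _ r2) big_split /= addrACA.
Qed.

Lemma TV_opp f : TV (- f) = TV f.
Proof.
rewrite /TV; apply: eq_esum => i _; apply: eq_esum => j _.
by rewrite !fctE -!opprD !normrN.
Qed.

Lemma TV0 : TV (0 : Z2 -> R) = 0%E.
Proof.
rewrite /TV; apply: esum1 => i _; apply: esum1 => j _.
have zE x : (0 : Z2 -> R) x = 0 by [].
by rewrite !zE subrr normr0 addr0.
Qed.

Definition restr V f := patch (fun=> 0) V f.

Lemma restrT V f x : V x -> restr V f x = f x.
Proof. by move=> Vx; rewrite /restr /patch mem_set. Qed.

Lemma restrN V f x : ~ V x -> restr V f x = 0.
Proof. by move=> Vx; rewrite /restr /patch memNset. Qed.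

Lemma restr_opp V f : restr V (- f) = - restr V f.
Proof.
apply/funext => x; rewrite -[RHS]/(- restr V f x).
have [Vx|nVx] := pselect (V x); first by rewrite !restrT.
by rewrite !restrN // oppr0.
Qed.

(** The clauses are invariant under negating [g] and [h], so they cover the supports removed by
    [opL] and by [opU] alike. The set [E] is the source of strict nesting. *)
Definition pulse_set k g h V :=
  [/\ connected_set r V, (V #= `I_k.+1)%card, flat (g - h) V,
      forall p q, V p -> ~ V q -> r p q -> g q != g p &
      exists E, [/\ connected_set r E, V `<` E & flat h E]].

Definition disjoint_sets V W : bool := `[< V `&` W = set0 >].

Definition pulse_step k g h (s : seq (set Z2)) :=
  [/\ pairwise disjoint_sets s,
      forall V, V \in s -> pulse_set k g h V,
      g - h = \sum_(V <- s) restr V (g - h) &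
      TV g = (TV h + \sum_(V <- s) TV (restr V (g - h)%R))%E].

Lemma pulse_set_opp k g h V : pulse_set k g h V -> pulse_set k (- g) (- h) V.
Proof.
move=> [cV Vk gh exitV [E [cE VE hE]]]; split=> //.
- by rewrite -opprD; exact: flat_opp.
- by move=> p q Vp nVq rpq; rewrite !fctE eqr_opp exitV.
- by exists E; split=> //; exact: flat_opp.
Qed.

Lemma pulse_step_opp k g h s : pulse_step k g h s -> pulse_step k (- g) (- h) s.
Proof.
move=> [ds ps sum_s TV_s]; split=> //.
- by move=> V /ps; exact: pulse_set_opp.
- rewrite -opprD (eq_bigr _ (fun V _ => restr_opp V _)) {1}sum_s.
  by rewrite raddf_sum.
- rewrite !TV_opp TV_s; congr (_ + _)%E; apply: eq_bigr => V _.
  by rewrite -opprD restr_opp TV_opp.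
Qed.

(** The plateaus that [opL r k.+1] lowers when [opL r k] fixes [g]. *)
Definition peak k g V :=
  [/\ connected_set r V, (V #= `I_k.+1)%card, flat g V &
      forall p q, V p -> ~ V q -> r p q -> g q < g p].

(** An edge of [W] leaving [V] would descend strictly because of [V] and be level because of [W]. So
    [W] lies in [V], and equal cardinality concludes. *)
Lemma peak_intersecting k g V W x : peak k g V -> peak k g W -> V x -> W x -> V = W.
Proof.
move=> [cV Vk gV exitV] [cW Wk gW exitW] Vx Wx.
suff WV : W `<=` V by rewrite (card_subset_eq WV Wk Vk).
move=> y Wy; apply: contrapT => nVy.
have [u [v [Wu Vu Wv nVv ruv]]] := connected_exit cW Wx Vx Wy nVy.
by have := exitV _ _ Vu nVv ruv; rewrite (gW v u) // ltxx.
Qed.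

Section OpL.
Variables (k : nat) (g : Z2 -> R).
Hypotheses (fin_g : finite_set (range g)) (fix_g : opL_fixed r k g).
Let h := opL r k.+1 g.

Lemma subset_exit W V x : connected_set r W -> (W #= `I_k.+2)%card ->
  (V #= `I_k.+1)%card -> W x -> V x ->
  exists u v, [/\ W u, V u, W v, ~ V v & r u v].
Proof.
move=> cW Wk Vk Wx Vx.
have [q Wq nVq] := card_lt_not_subset Wk Vk (leqnn _).
exact: connected_exit cW Wx Vx Wq nVq.
Qed.

(** The peak is the witness from [fix_g]. An outer neighbor not below [g x] could be added to it,
    against [h x < g x]. If the witness of another point [y] misses [x], it leaves the peak through
    a point below [g x], whence [g y <= g x]. *)
Lemma peak_at x : h x < g x -> exists2 V, peak k g V & V x.
Proof.
move=> hx; have [V [cV Vx Vk] gV] := fix_g x; exists V => //.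
have exitV p q : V p -> ~ V q -> r p q -> g q < g x.
  move=> Vp nVq rpq; rewrite ltNge; apply/negP => gq.
  have NVq : nbhd_sets r k.+1 x (V `|` [set q]) by apply: nbhd_sets_setU1 rpq.
  have : g x <= h x by apply: (opL_ge fin_g NVq) => y [/gV//|->].
  by rewrite leNgt hx.
have gVx y : V y -> g y = g x.
  move=> Vy; apply/eqP; rewrite eq_le (gV y Vy) andbT.
  have [W [cW Wy Wk] gW] := fix_g y.
  have [Wx|nWx] := pselect (W x); first exact: gW.
  have [WV|nWV] := pselect (W `<=` V).
    by rewrite (card_subset_eq WV Wk Vk) in nWx.
  have [q Wq nVq] : exists2 q, W q & ~ V q.
    apply: contrapT => nex; apply: nWV => q Wq; apply: contrapT => nVq.
    by apply: nex; exists q.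
  have [u [v [Wu Vu Wv nVv ruv]]] := connected_exit cW Wy Vy Wq nVq.
  exact: le_trans (gW _ Wv) (ltW (exitV _ _ Vu nVv ruv)).
split=> // [y z /gVx -> /gVx -> //|p q Vp nVq rpq].
by rewrite (gVx p) //; exact: exitV rpq.
Qed.

(** A neighborhood of [k.+2] points overflows the peak, along an edge of strict descent. *)
Lemma peak_lt V y : peak k g V -> V y -> h y < g y.
Proof.
move=> [cV Vk gV exitV] Vy; rewrite ltNge; apply/negP => hy.
have [W [cW Wy Wk] gW] := opL_attained hr k.+1 y fin_g.
have [u [v [Wu Vu Wv nVv ruv]]] := subset_exit cW Wk Vk Wy Vy.
have := exitV _ _ Vu nVv ruv; rewrite (gV u y) // ltNge.
by rewrite (le_trans hy (gW v Wv)).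
Qed.

Lemma opL_off_peaks x : (forall V, peak k g V -> ~ V x) -> h x = g x.
Proof.
move=> nx; apply/eqP; rewrite eq_le opL_le //= leNgt; apply/negP => /peak_at.
by move=> [V /nx].
Qed.

(** If [q] were in another peak, [p] and [q] would each be strictly above the other. The inequality
    holds because the connected pair [p], [q] inherits the lower bound [h q]. *)
Lemma peak_exit V p q : peak k g V -> V p -> ~ V q -> r p q ->
  h q = g q /\ h q <= h p.
Proof.
move=> pV Vp nVq rpq; have [cV Vk gV exitV] := pV; split.
  apply: opL_off_peaks => W pW Wq; have [_ _ _ exitW] := pW.
  have nWp : ~ W p by move=> Wp; apply: nVq; rewrite (peak_intersecting pV pW Vp Wp).
  have := exitW _ _ Wq nWp; rewrite r_sym => /(_ rpq).
  by rewrite ltNge (ltW (exitV _ _ Vp nVq rpq)).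
apply: (@opL_ge_connected _ _ hr k.+1 g ([set p] `|` [set q]) _ q) => //.
- by apply: connected_setU rpq => //; exact: connected_set1.
- have hq : h q <= g q by exact: opL_le.
  move=> _ [->|->] //; exact: le_trans hq (ltW (exitV _ _ Vp nVq rpq)).
- by right.
- by left.
Qed.

Lemma flat_opL_peak V : peak k g V -> flat h V.
Proof. by move=> [cV _ gV _]; exact: flat_opL. Qed.

(** The larger set is [V] with one outer neighbor [q], through which an optimal set for a point of
    [V] leaves [V]. That set gives [h <= h q] on [V], and [peak_exit] the converse. *)
Lemma peak_pulse_set V : peak k g V -> V !=set0 -> pulse_set k g h V.
Proof.
move=> pV [x Vx]; have [cV Vk gV exitV] := pV; have hV := flat_opL_peak pV.
split=> //.
- by move=> y z Vy Vz; rewrite !fctE (gV y z) // (hV y z).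
- by move=> p q Vp nVq rpq; rewrite lt_eqF // exitV.
have [W [cW Wx Wk] gW] := opL_attained hr k.+1 x fin_g.
have [p [q [Wp Vp Wq nVq rpq]]] := subset_exit cW Wk Vk Wx Vx.
exists (V `|` [set q]); split.
- by apply: connected_setU Vp _ rpq => //; exact: connected_set1.
- by split=> [y|H]; [left|apply: nVq; apply: H; right].
have hq y : V y -> h y = h q.
  move=> Vy; rewrite (hV y p) //; apply/eqP; rewrite eq_le.
  have [hqg ->] := peak_exit pV Vp nVq rpq; rewrite andbT (hV p x) // hqg.
  exact: gW.
by move=> y z [/hq->|->] [/hq->|->].
Qed.

Lemma opL_peak_edge V x y : peak k g V -> V x -> ~ V y -> r x y ->
  `|g y - g x| = `|h y - h x| + (g x - h x).
Proof.
move=> pV Vx nVy rxy; have [hgy hxy] := peak_exit pV Vx nVy rxy.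
have [_ _ _ exitV] := pV; have gxy := exitV _ _ Vx nVy rxy.
rewrite (distrC (g y)) (distrC (h y)) !ger0_norm ?subr_ge0 // ?(ltW gxy) //.
by rewrite hgy [RHS]addrC addrA subrK.
Qed.

(** Every nonempty peak contains one of the finitely many points where [h] is below [g], so choosing
    a peak at each of these points lists them all. *)
Lemma peaks_finite : finite_set [set x | g x != 0] ->
  finite_set [set x | h x != 0] ->
  exists s : seq (set Z2),
    [/\ uniq s, forall V, V \in s -> peak k g V /\ V !=set0 &
        forall V x, peak k g V -> V x -> V \in s].
Proof.
move=> fin_sg fin_sh; set D := [set x | h x < g x].
have fin_D : finite_set D.
  apply: sub_finite_set (_ : finite_set ([set x | g x != 0] `|` [set x | h x != 0])).
    move=> x /= hgx; have [gx|] := eqVneq (g x) 0; last by left.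
    by right; rewrite lt_eqF // -gx.
  by rewrite finite_setU.
have [pk pkP] : {pk : Z2 -> set Z2 & forall x, D x -> peak k g (pk x) /\ pk x x}.
  apply: (@choice _ _ (fun x V => D x -> peak k g V /\ V x)) => x.
  have [/peak_at [V pV Vx]|nDx] := pselect (D x); first by exists V.
  by exists set0.
have [s sP] := (finite_seqP _).1 (finite_image pk fin_D).
exists (undup s); split; first exact: undup_uniq.
  move=> V; rewrite mem_undup => Vs.
  have : [set` s] V by [].
  by rewrite -sP => -[x Dx <-]; have [pV Vx] := pkP x Dx; split=> //; exists x.
move=> V x pV Vx; rewrite mem_undup.
have Dx := peak_lt pV Vx; have [pV' Vx'] := pkP x Dx.
suff : [set` s] V by [].
by rewrite -sP; exists x => //; exact: peak_intersecting pV' pV Vx' Vx.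
Qed.

(** For the variation there are three kinds of edges: inside one peak all increments vanish, off the
    peaks [g] and [h] agree and the pulses are zero, and on an edge leaving a peak exactly one pulse
    changes. *)
Lemma opL_pulse_step : finite_set [set x | g x != 0] ->
  finite_set [set x | h x != 0] -> exists s, pulse_step k g h s.
Proof.
move=> fin_sg fin_sh; have [s [us sP Ps]] := peaks_finite fin_sg fin_sh.
have disj V W : V \in s -> W \in s -> V != W -> forall x, V x -> ~ W x.
  move=> /sP[pV _] /sP[pW _] VW x Vx Wx; move/eqP: VW; apply.
  exact: peak_intersecting pV pW Vx Wx.
have sum1 (F : set Z2 -> R) V : V \in s ->
    (forall W, W \in s -> W != V -> F W = 0) -> \sum_(W <- s) F W = F V.
  move=> Vs F0; rewrite (bigD1_seq V) //= big_seq_cond big1 ?addr0 //.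
  by move=> W /andP[]; exact: F0.
have phi0 V W x : V \in s -> V x -> W \in s -> W != V -> restr W (g - h) x = 0.
  by move=> Vs Vx Ws WV; rewrite restrN //; move=> Wx; exact: (disj W V _ _ _ x).
have phiN x : (forall V, peak k g V -> ~ V x) ->
    forall V, V \in s -> restr V (g - h) x = 0.
  by move=> nx V /sP[/nx nVx _]; rewrite restrN.
have in_edge x y V : V \in s -> V x -> ~ V y -> r x y ->
    `|g y - g x| = `|h y - h x| +
      \sum_(W <- s) `|restr W (g - h) y - restr W (g - h) x|.
  move=> Vs Vx nVy rxy; have [pV _] := sP V Vs; have [_ _ _ exitV] := pV.
  (* No edge joins two peaks, since each endpoint would be strictly above the other. *)
  have ny W : peak k g W -> ~ W y.
    move=> pW Wy; have [_ _ _ exitW] := pW.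
    have nWx : ~ W x by move=> Wx; apply: nVy; rewrite (peak_intersecting pV pW Vx Wx).
    have := exitW _ _ Wy nWx; rewrite r_sym => /(_ rxy).
    by rewrite ltNge (ltW (exitV _ _ Vx nVy rxy)).
  rewrite (opL_peak_edge pV Vx nVy rxy); congr (_ + _).
  rewrite (sum1 _ V) //; last first.
    by move=> W Ws WV; rewrite phiN // (phi0 V) // subrr normr0.
  rewrite phiN // restrT // sub0r normrN ger0_norm //.
  by rewrite !fctE subr_ge0 ltW // (peak_lt pV).
exists s; split.
- move: us; rewrite uniq_pairwise.
  apply: (@sub_in_pairwise _ (mem s)) => [V W Vs Ws /= VW|]; last exact/allP.
  by apply/asboolP/seteqP; split=> // x [Vx]; exact: disj Vx.
- by move=> V /sP[]; exact: peak_pulse_set.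
- apply/funext => x; rewrite fct_sumE.
  have [[V pV Vx]|nx] := pselect (exists2 V, peak k g V & V x).
    have Vs := Ps V x pV Vx.
    by rewrite (sum1 _ V) ?restrT // => W; exact: phi0.
  have nx' V : peak k g V -> ~ V x by move=> pV Vx; apply: nx; exists V.
  rewrite !fctE opL_off_peaks // subrr big_seq big1 // => V.
  exact: phiN.
apply: TV_edge_sum => x y rxy.
have [[V pV Vx]|nx] := pselect (exists2 V, peak k g V & V x).
  have Vs := Ps V x pV Vx.
  have [Vy|nVy] := pselect (V y); last exact: (in_edge _ _ V).
  have [_ _ gV _] := pV; have hV := flat_opL_peak pV.
  rewrite (gV x y) // (hV x y) // !subrr normr0 add0r big_seq big1 // => W Ws.
  have [->|WV] := eqVneq W V; last by rewrite !(phi0 V) // subrr normr0.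
  by rewrite !restrT // !fctE (gV x y) // (hV x y) // subrr normr0.
have [[V pV Vy]|ny] := pselect (exists2 V, peak k g V & V y).
  have Vs := Ps V y pV Vy; have nVx : ~ V x by move=> Vx; apply: nx; exists V.
  rewrite distrC (in_edge y x V) //; last by rewrite r_sym.
  rewrite distrC; congr (_ + _); apply: eq_bigr => W _; exact: distrC.
have nx' V : peak k g V -> ~ V x by move=> pV Vx; apply: nx; exists V.
have ny' V : peak k g V -> ~ V y by move=> pV Vy; apply: ny; exists V.
rewrite !opL_off_peaks // big_seq big1 ?addr0 // => V Vs.
by rewrite !phiN // subrr normr0.
Qed.

End OpL.

Lemma opU_pulse_step k g :
  finite_set (range g) -> opL_fixed r k (- g) ->
  finite_set [set x | g x != 0] -> finite_set [set x | opU r k.+1 g x != 0] ->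
  exists s, pulse_step k g (opU r k.+1 g) s.
Proof.
rewrite opU_opp => fin_g fix_g fin_sg fin_sh.
have [|||s s_step] := @opL_pulse_step k (- g) _ fix_g.
- exact: finite_rangeN.
- by apply: sub_finite_set fin_sg => x /=; rewrite fctE oppr_eq0.
- by apply: sub_finite_set fin_sh => x /=; rewrite fctE oppr_eq0.
by exists s; rewrite -[g in pulse_step k g]opprK; exact: pulse_step_opp.
Qed.

End Peaks.

(** * Finite support is preserved, and large levels give zero *)

Section Escape.
Variables (R : realType) (r : rel Z2).
Hypothesis hr : neighbor_relation r.
Implicit Types (f g : Z2 -> R) (A B : set Z2).

(** This is what keeps a function zero off [B] under both operators. *)
Definition escapable B :=
  forall n x, ~ B x -> exists2 V, nbhd_sets r n x V & forall y, V y -> ~ B y.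

(** A square box serves as [B]: a point outside has a coordinate beyond its range, and the ray along
    that axis away from the box never meets it. *)
Lemma finite_set_escapable A :
  finite_set A -> exists B, [/\ finite_set B, A `<=` B & escapable B].
Proof.
move=> /finite_seqP[s ->].
have [M MP] : exists M : nat, forall x, x \in s ->
    (`|x.1| <= M)%N /\ (`|x.2| <= M)%N.
  elim: s => [|a s [M MP]]; first by exists 0%N.
  exists (`|a.1| + `|a.2| + M)%N => x; rewrite inE => /orP[/eqP->|/MP[]]; lia.
pose J := [set i : int | - M%:Z <= i <= M%:Z].
exists (J `*` J); split.
- suff fin_J : finite_set J by exact: finite_setX.
  apply: sub_finite_set (_ : finite_set ((fun a : nat => a%:Z - M%:Z) @` `I_(M + M).+1)).
    by move=> i /= /andP[i1 i2]; exists (absz (i + M%:Z)); rewrite /=; lia.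
  exact: finite_image.
- by move=> x /= /MP[]; rewrite /J /=; lia.
move=> n [i j] nB.
have [_ _ _ rd] := hr.
have go (d : Z2) (height : Z2 -> int) :
    (forall p, r p (p + d)) -> (forall p, height (p + d) = height p + 1) ->
    (forall y, (J `*` J) y -> height y <= M%:Z) -> M%:Z < height (i, j) ->
    exists2 V, nbhd_sets r n (i, j) V & forall y, V y -> ~ (J `*` J) y.
  move=> rpd hd hM Mh; have [V NV hV] := nbhd_sets_ray hr n (i, j) rpd hd.
  exists V => // y /hV h1 /hM h2; move: (lt_le_trans Mh (le_trans h1 h2)).
  by rewrite ltxx.
have [i1|i1] := ltP M%:Z i.
  apply: (go (1, 0) fst) => // [[a b]|y]; last by rewrite /J /=; lia.
  by have [H _ _ _] := rd a b; rewrite -[b in (a + 1, b)]addr0 in H.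
have [i2|i2] := ltP i (- M%:Z).
  apply: (go (- 1, 0) (fun x => - x.1)) => [[a b]|[a b]|y|].
  - by have [_ H _ _] := rd a b; rewrite -[b in (a - 1, b)]addr0 in H.
  - by rewrite /= opprD opprK.
  - by rewrite /J /=; lia.
  - by rewrite /=; lia.
have [j1|j1] := ltP M%:Z j.
  apply: (go (0, 1) snd) => // [[a b]|y]; last by rewrite /J /=; lia.
  by have [_ _ H _] := rd a b; rewrite -[a in (a, b + 1)]addr0 in H.
have [j2|j2] := ltP j (- M%:Z).
  apply: (go (0, - 1) (fun x => - x.2)) => [[a b]|[a b]|y|].
  - by have [_ _ _ H] := rd a b; rewrite -[a in (a, b - 1)]addr0 in H.
  - by rewrite /= opprD opprK.
  - by rewrite /J /=; lia.
  - by rewrite /=; lia.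
by case: nB; split; rewrite /J /= ?i1 ?i2 ?j1 ?j2.
Qed.

Section Support.
Variables (B : set Z2).
Hypotheses (fin_B : finite_set B) (esc_B : escapable B).

Definition supported f := forall x, ~ B x -> f x = 0.

Lemma supported_opp f : supported f -> supported (- f).
Proof. by move=> fB x nBx; rewrite !fctE fB // oppr0. Qed.

Lemma supported_finite_range f : supported f -> finite_set (range f).
Proof.
move=> fB; apply: sub_finite_set (_ : finite_set (f @` B `|` [set 0])).
  move=> _ [x _ <-]; have [Bx|nBx] := pselect (B x); last by right; exact: fB.
  by left; exists x.
by rewrite finite_setU; split; [exact: finite_image|exact: finite_set1].
Qed.

Lemma supported_finite_supp f : supported f -> finite_set [set x | f x != 0].
Proof.
move=> fB; apply: sub_finite_set fin_B => x /= fx; apply: contrapT => /fB fx0.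
by rewrite fx0 eqxx in fx.
Qed.

Lemma supported_opL n f : supported f -> supported (opL r n f).
Proof.
move=> fB x nBx; have fin_f := supported_finite_range fB.
apply/eqP; rewrite eq_le; apply/andP; split.
  by apply: (le_trans (opL_le hr n x fin_f)); rewrite fB.
have [V NV VB] := esc_B n nBx.
by apply: (opL_ge fin_f NV) => y /VB /fB ->.
Qed.

Lemma supported_opU n f : supported f -> supported (opU r n f).
Proof.
by move=> fB; rewrite opU_opp; do 2![apply: supported_opp; try apply: supported_opL].
Qed.

Lemma supported_opF n f : supported f -> supported (opF r n f).
Proof.
move=> fB; elim: n => //= n IH; apply: supported_opU; exact: supported_opL.
Qed.

(** A set of [n.+1] points does not fit into [B], so it contains a zero of [f]. *)
Lemma opL_le0 n b f x : (B #= `I_b)%card -> (b <= n)%N -> supported f ->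
  opL r n f x <= 0.
Proof.
move=> Bb bn fB; have fin_f := supported_finite_range fB.
have [V [cV Vx Vn] fV] := opL_attained hr n x fin_f.
have [y Vy nBy] : exists2 y, V y & ~ B y by exact: card_lt_not_subset Vn Bb _.
by rewrite -(fB y nBy) fV.
Qed.

(** After [opL] the function is nonpositive. Its opposite is nonnegative, and [opL] of that is
    nonnegative too, while [opL_le0] bounds it by 0. *)
Lemma opUL_eq0 n b f : (B #= `I_b)%card -> (b <= n)%N -> supported f ->
  opU r n (opL r n f) = 0.
Proof.
move=> Bb bn fB; have hB := supported_opL n fB.
have fin_h := supported_finite_range (supported_opp hB).
rewrite opU_opp; apply/funext => x.
suff -> : (- opL r n (- opL r n f)) x = - 0 by rewrite oppr0.
congr (- _); apply/eqP; rewrite eq_le (opL_le0 x Bb bn) /=; last first.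
  exact: supported_opp.
have [V NV] := nbhd_sets_nonempty hr n x.
apply: (opL_ge fin_h NV) => y _.
by rewrite !fctE oppr_ge0 (opL_le0 y Bb bn).
Qed.

End Support.
End Escape.

(** * Levels of the decomposition and their nesting *)

Section Levels.
Variables (R : realType) (r : rel Z2).
Hypothesis hr : neighbor_relation r.
Implicit Types (f g h : Z2 -> R) (V W E : set Z2).

Lemma flat_subset_pulse_set k g h V E :
  pulse_set r k g h V -> connected_set r E -> flat g E ->
  E `&` V !=set0 -> E `<=` V.
Proof.
move=> [_ _ _ exitV _] cE gE [x [Ex Vx]] y Ey; apply: contrapT => nVy.
have [u [v [Eu Vu Ev nVv ruv]]] := connected_exit cE Ex Vx Ey nVy.
by move/eqP: (exitV _ _ Vu nVv ruv); apply; exact: gE.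
Qed.

(** The exit-edge clause of [pulse_set] is replaced by its consequence for plateaus: for supports of
    the second step, exit edges are known only for the intermediate function, while plateaus of [g]
    remain plateaus of it. *)
Definition pulse_level g h (s : seq (set Z2)) :=
  [/\ pairwise disjoint_sets s,
      forall V, V \in s -> [/\ connected_set r V, flat (g - h) V,
        V !=set0 -> exists E, [/\ connected_set r E, V `<` E & flat h E] &
        forall E, connected_set r E -> flat g E -> E `&` V !=set0 -> E `<=` V],
      g - h = \sum_(V <- s) restr V (g - h) &
      TV g = (TV h + \sum_(V <- s) TV (restr V (g - h)%R))%E].

Lemma pulse_step_off k g h s x : pulse_step r k g h s ->
  (forall V, V \in s -> ~ V x) -> (g - h) x = 0.
Proof.
move=> [_ _ -> _] nx; rewrite fct_sumE big_seq big1 // => V /nx nVx.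
exact: restrN.
Qed.

(* A support of the second step cannot meet a support [V] of the first one: it
   would contain the larger set on which [h] is constant around [V], although
   all the supports have the same cardinality. *)
Lemma pulse_step_disjoint k g h h' s s' V W :
  pulse_step r k g h s -> pulse_step r k h h' s' ->
  V \in s -> W \in s' -> V `&` W = set0.
Proof.
move=> [_ ps _ _] [_ ps' _ _] Vs Ws; apply/seteqP; split=> // x [Vx Wx].
have [_ Vk _ _ [E [cE [VE nEV] hE]]] := ps V Vs.
have pW := ps' W Ws; have [_ Wk _ _ _] := pW.
have EW : E `<=` W.
  apply: (flat_subset_pulse_set pW) => //; by exists x; split=> //; exact: VE.
apply: nEV; rewrite (card_subset_eq _ Vk Wk) //.
exact: subset_trans EW.
Qed.

(** Supports of the two steps are disjoint, so on each support only one step contributes to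
    [g - h']. The leading [set0] carries a zero pulse and keeps the list nonempty when nothing is
    removed. *)
Lemma pulse_level_comp k g h h' s s' :
  (forall E, connected_set r E -> flat g E -> flat h E) ->
  (forall E, connected_set r E -> flat h E -> flat h' E) ->
  pulse_step r k g h s -> pulse_step r k h h' s' ->
  pulse_level g h' (set0 :: s ++ s').
Proof.
move=> flat_gh flat_hh' st st'.
have disj := pulse_step_disjoint st st'.
have ghE : g - h' = (g - h) + (h - h') by rewrite addrA subrK.
have ghE' x : (g - h') x = (g - h) x + (h - h') x by rewrite ghE.
have restr_s V : V \in s -> restr V (g - h') = restr V (g - h).
  move=> Vs; apply/funext => x; have [Vx|nVx] := pselect (V x); last by rewrite !restrN.
  rewrite !restrT // ghE' (pulse_step_off st') ?addr0 // => W Ws Wx.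
  by have : (V `&` W) x by []; rewrite disj.
have restr_s' V : V \in s' -> restr V (g - h') = restr V (h - h').
  move=> Vs; apply/funext => x; have [Vx|nVx] := pselect (V x); last by rewrite !restrN.
  rewrite !restrT // ghE' (pulse_step_off st) ?add0r // => W Ws Wx.
  by have : (W `&` V) x by []; rewrite disj.
have restr0 u : restr set0 u = 0 :> (Z2 -> R).
  by apply/funext => x; rewrite restrN.
have flat_restr (u u' : Z2 -> R) V : restr V u = restr V u' -> flat u' V -> flat u V.
  move=> uu' fu' x y Vx Vy; rewrite -(restrT u Vx) -(restrT u Vy) uu'.
  by rewrite !restrT //; exact: fu'.
have [ds ps sum_s TV_s] := st; have [ds' ps' sum_s' TV_s'] := st'.
split.
- rewrite /= pairwise_cat ds ds' !andbT; apply/andP; split.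
    by apply/allP => V _; apply/asboolP; rewrite set0I.
  by apply/allrelP => V W Vs Ws; apply/asboolP; exact: disj.
- move=> V; rewrite inE mem_cat => /or3P[/eqP->|Vs|Vs].
  + by split=> [p q []|p q []|[p []]|E _ _ [p []]].
  + have pV := ps V Vs; have [cV _ fV _ [E [cE VE hE]]] := pV; split=> //.
    * exact: (flat_restr _ _ _ (restr_s _ Vs) fV).
    * by move=> _; exists E; split=> //; exact: flat_hh'.
    * by move=> E' cE' gE'; exact: (flat_subset_pulse_set pV).
  + have pV := ps' V Vs; have [cV _ fV _ exE] := pV; split=> //.
    * exact: (flat_restr _ _ _ (restr_s' _ Vs) fV).
    * move=> E cE gE; apply: (flat_subset_pulse_set pV) => //; exact: flat_gh.
- rewrite big_cons restr0 add0r big_cat /= [LHS]ghE sum_s sum_s'.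
  congr (_ + _); apply: eq_big_seq => V Vs; first by rewrite restr_s.
  by rewrite restr_s'.
- rewrite big_cons restr0 TV0 add0e big_cat /= TV_s TV_s'.
  rewrite -addeA [X in _ = (_ + X)%E]addeC; congr (_ + (_ + _))%E.
    by apply: eq_big_seq => V Vs; rewrite restr_s'.
  by apply: eq_big_seq => V Vs; rewrite restr_s.
Qed.

(** Both operators of level [k] fix [g], and [opL r k.+1] preserves being fixed by [opU r k], so the
    second step can start from [h]. *)
Lemma pulse_level_opF B f k : finite_set B -> escapable r B -> supported B f ->
  exists2 s, pulse_level (opF r k f) (opF r k.+1 f) s & (0 < size s)%N.
Proof.
move=> fin_B esc_B fB; set g := opF r k f; set h := opL r k.+1 g.
have gB : supported B g by exact: supported_opF.
have hB : supported B h by exact: supported_opL.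
have uB : supported B (opU r k.+1 h) by exact: supported_opU.
have fin_f := supported_finite_range fin_B fB.
have fin_g := supported_finite_range fin_B gB.
have fin_h := supported_finite_range fin_B hB.
have fin_supp := fun u => @supported_finite_supp R B fin_B u.
have [s st] : exists s, pulse_step r k g h s.
  by apply: opL_pulse_step => //; [exact: opL_fixed_opF|exact: fin_supp..].
have [s' st'] : exists s, pulse_step r k h (opU r k.+1 h) s.
  apply: opU_pulse_step => //; [|exact: fin_supp..].
  by apply: opU_fixed_opL => //; exact: opU_fixed_opF.
exists (set0 :: s ++ s') => //; apply: (pulse_level_comp _ _ st st').
- by move=> E cE; exact: flat_opL.
- by move=> E cE; exact: flat_opU.
Qed.

End Levels.

Theorem mainTheorem5 (R : realType) (r : rel Z2) (hr : neighbor_relation r)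
    (f : Z2 -> R) (hf : finite_set [set x | f x != 0]) :
  exists (gamma : nat -> nat) (phi : nat -> nat -> (Z2 -> R))
         (supp : nat -> nat -> set Z2),
    (forall k, (1 <= k)%N -> (1 <= gamma k)%N) /\
    (forall k s, (1 <= k)%N -> (1 <= s <= gamma k)%N ->
       pulse_with_support r (phi k s) (supp k s)) /\
    (forall k, (1 <= k)%N ->
       ((id \- (opU r k \o opL r k)) \o opF r k.-1) f =
       \sum_(1 <= s < (gamma k).+1) phi k s) /\
    (forall k s1 s2, (1 <= k)%N ->
       (1 <= s1 <= gamma k)%N -> (1 <= s2 <= gamma k)%N -> s1 <> s2 ->
       supp k s1 `&` supp k s2 = set0) /\
    (forall k1 k2 s1 s2, (1 <= k1)%N -> (k1 < k2)%N ->
       (1 <= s1 <= gamma k1)%N -> (1 <= s2 <= gamma k2)%N ->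
       supp k1 s1 `&` supp k2 s2 <> set0 ->
       supp k1 s1 `<` supp k2 s2) /\
    (exists m0 : nat, forall m, (m0 <= m)%N ->
       exists c : R,
         opF r m f = cst c /\
         f = \sum_(1 <= k < m.+1) \sum_(1 <= s < (gamma k).+1) phi k s
             + cst c /\
         TV f = (\sum_(1 <= k < m.+1) \sum_(1 <= s < (gamma k).+1)
                   TV (phi k s))%E).
Proof.
have [B [fin_B fB esc_B]] := finite_set_escapable hr hf.
have {fB} fB : supported B f.
  by move=> x nBx; apply: contrapT => /eqP /(fB x).
have fin_f := supported_finite_range fin_B fB.
have /choice[s sP] k : exists s,
    pulse_level r (opF r k f) (opF r k.+1 f) s /\ (0 < size s)%N.
  by have [s] := pulse_level_opF hr k fin_B esc_B fB; exists s.
(* Level [k] is the passage from [opF r k.-1 f] to [opF r k f], and pulses are numbered from 1,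
   whence the predecessors. *)
pose gamma k := size (s k.-1).
pose supp k i := nth set0 (s k.-1) i.-1.
pose phi k i := restr (supp k i) (opF r k.-1 f - opF r k f).
have bigE (T : Type) (idx : T) (op : T -> T -> T) (F : set Z2 -> T) k :
    \big[op/idx]_(1 <= i < (gamma k.+1).+1) F (supp k.+1 i) =
    \big[op/idx]_(V <- s k) F V.
  by rewrite big_add1 (big_nth set0).
have suppP k i : (1 <= i <= gamma k.+1)%N -> supp k.+1 i \in s k.
  by case: i => // i /andP[_ ile]; apply: mem_nth.
exists gamma, phi, supp; split; [|split; [|split; [|split; [|split]]]].
- by move=> k _; have [_] := sP k.-1.
- move=> [//|k] i _ ile.
  have [[_ /(_ _ (suppP k i ile))[cV fV _ _] _ _] _] := sP k; split=> //.
  have [[x Vx]|nV] := pselect (supp k.+1 i !=set0).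
    exists ((opF r k f - opF r k.+1 f) x).
    by split=> y Vy; [rewrite /phi restrT //; exact: fV|exact: restrN].
  exists 0; split=> y Vy; last exact: restrN.
  by case: nV; exists y.
- move=> [//|k] _; have [[_ _ sum_s _] _] := sP k.
  rewrite (bigE _ 0 +%R (fun V => restr V (opF r k f - opF r k.+1 f))).
  by rewrite -sum_s.
- move=> [//|k] i j _ ile jle ij; have [[/(pairwiseP set0) disj _ _ _] _] := sP k.
  have bound l : (1 <= l <= gamma k.+1)%N -> l.-1 \in gtn (size (s k)).
    by case: l => // l /andP[_].
  have [lt_ij|lt_ji|] := ltngtP i.-1 j.-1.
  + exact/asboolP/(disj _ _ (bound _ ile) (bound _ jle)).
  + by rewrite setIC; exact/asboolP/(disj _ _ (bound _ jle) (bound _ ile)).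
  + by move: i j ile jle ij => [//|i] [//|j] _ _ ij /= eij; case: ij; rewrite eij.
- move=> [//|k] [//|l] i j _ lt_kl ile jle; have [[_ ps _ _] _] := sP k.
  have [cV _ exE _] := ps _ (suppP k i ile).
  have [[_ ps' _ _] _] := sP l; have [_ _ _ subW] := ps' _ (suppP l j jle).
  move=> /eqP/set0P[x [Vx Wx]]; have [|E [cE [VE nEV] fE]] := exE; first by exists x.
  (* The set [E] is flat at stage [k.+1], hence still at stage [l], so the later support absorbs it.
     Strictness follows because [E] properly contains the earlier support. *)
  have EW : E `<=` supp l.+1 j.
    apply: subW => //; first exact: (@flat_opF _ _ hr k.+1 l).
    by exists x; split=> //; exact: VE.
  by split=> [|WV]; [exact: subset_trans EW|apply: nEV; exact: subset_trans WV].
(* Here [b] is the size of [B]. Starting at [b.+1] makes the level positive, so that [opF] ends with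
   a smoothing of level at least [b]. *)
have [b Bb] := (finite_setP B).1 fin_B; exists b.+1 => -[//|m] bm; exists 0.
have F0 : opF r m.+1 f = 0.
  by apply: (opUL_eq0 hr fin_B esc_B Bb); [exact: ltnW|exact: supported_opF].
(* Telescoping: after [n] levels the remainder is [opF r n f], in the sum as in the total
   variation. *)
have sumP n : f = \sum_(1 <= k < n.+1) \sum_(1 <= i < (gamma k).+1) phi k i
    + opF r n f /\
    TV f = (\sum_(1 <= k < n.+1) \sum_(1 <= i < (gamma k).+1) TV (phi k i)
            + TV (opF r n f))%E.
  elim: n => [|n [IH1 IH2]]; first by rewrite !big_geq // add0r add0e.
  rewrite !(@big_nat_recr _ _ _ n.+1 1) //=.
  rewrite (bigE _ 0 +%R (fun V => restr V (opF r n f - opF r n.+1 f))).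
  rewrite (bigE _ 0%E +%E (fun V => TV (restr V (opF r n f - opF r n.+1 f)))).
  have [[_ _ sum_s TV_s] _] := sP n; split.
    by rewrite -sum_s -addrA subrK.
  by rewrite {1}IH2 TV_s [X in (_ + X)%E]addeC addeA.
have [sum_f TV_f] := sumP m.+1; split; first exact: F0.
split; first by rewrite {1}sum_f F0.
by rewrite TV_f F0 TV0 adde0.
Qed.
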